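(* Let $k$ be a field and let $f:\mathbb{N}\rightarrow\mathbb{N}$ be a monotonely increasing function ($f(n)<f(n+1)$ for all $n$) which is submultiplicative ($f(n+m)\leq f(n)f(m)$ for all $n,m$), such that: (1) there exists a positive integer $\alpha$ for which $nf(n)\leq f(\alpha n)$ for all $n\in\mathbb{N}$; (2) for every real $\beta>0$ there is some $n_\beta\in\mathbb{N}$ such that for all $n\geq n_\beta$ we have $f(2^{n+1})\leq \frac{1}{\beta}f(2^n)^2$; (3) $\prod_{n=0}^{\infty}\left(1+\frac{f(2^n)}{f(2^{n+1})}\right)<\infty$. Then there exists a finitely generated simple $k$-algebra with growth type $\sim f$.
   Context: Here $\mathbb{N}=\{1,2,3,\dots\}$ for arguments and values of $f$; algebras are associative over the field $k$. Growth: for a finitely generated algebra $R$ with a finite-dimensional generating subspace $V\ni 1$, the growth function is $n\mapsto \dim_k V^n$. For monotonely increasing $f,g$ write $f\sim g$ if there exist positive integers $C,D$ with $f(n)\leq g(Cn)\leq f(Dn)$ for all $n$. The growth function of $R$ is well defined up to $\sim$, and ''$R$ has growth type $\sim f$'' means its growth function is $\sim f$. *)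

(* Defs.v *)
From HB Require Import structures.
From mathcomp Require Import all_boot all_order all_algebra.
From mathcomp Require Import all_classical all_reals all_analysis.
Set Implicit Arguments.
Unset Strict Implicit.
Unset Printing Implicit Defensive.
Import Order.TTheory GRing.Theory Num.Theory.
Import numFieldNormedType.Exports.
Local Open Scope classical_set_scope.
Local Open Scope ring_scope.

Section LinearAlgebra.
Variables (k : fieldType) (M : lmodType k).
Implicit Types (U X : set M).

Definition linear_subspace U := submod_closed (mem U).

Definition linear_span X : set M := smallest linear_subspace X.

Definition lin_indep d (e : 'I_d -> M) :=
  forall c : 'I_d -> k, \sum_(i < d) c i *: e i = 0 -> forall i, c i = 0.

Definition is_basis U d (e : 'I_d -> M) :=
  lin_indep e /\ linear_span (range e) = U.

Definition has_dim U (d : nat) := exists e : 'I_d -> M, is_basis U e.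

Definition finite_dim U := exists d, has_dim U d.

(* Junk value 0 when U is not a finite-dimensional subspace. *)
Definition subspace_dim U : nat := xget 0%N [set d | has_dim U d].

End LinearAlgebra.

Section Algebras.
Variables (k : fieldType) (A : algType k).
Implicit Types (V X I : set A).

Definition subalgebra X := subalg_closed (mem X).

Definition generated_subalgebra X : set A := smallest subalgebra X.

Definition finitely_generated :=
  exists s : seq A, generated_subalgebra [set` s] = setT.

Definition two_sided_ideal I :=
  zmod_closed (mem I) /\ forall a x, I x -> I (a * x) /\ I (x * a).

(* An algType is nonzero by definition, so 1 <> 0 need not be required. *)
Definition simple_algebra :=
  forall I, two_sided_ideal I -> I = [set 0] \/ I = setT.

Definition subspace_power V (n : nat) : set A :=
  linear_span [set \prod_(i < n) v i | v in [set v : 'I_n -> A | forall i, V (v i)]].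

Definition generating_subspace V :=
  [/\ linear_subspace V, finite_dim V, V 1 & generated_subalgebra V = setT].

Definition growth V (n : nat) : nat := subspace_dim (subspace_power V n).

End Algebras.

(* Growth functions live on the positive integers: values at 0 are ignored. *)
Definition growth_equiv (f g : nat -> nat) :=
  exists C D : nat, [/\ (0 < C)%N, (0 < D)%N &
    forall n : nat, (0 < n)%N -> (f n <= g (C * n) <= f (D * n))%N].

(* The growth function is defined only up to growth_equiv, hence the
   quantification over all V; it is not vacuous for finitely generated A. *)
Definition has_growth_type (k : fieldType) (A : algType k) (f : nat -> nat) :=
  forall V : set A, generating_subspace V -> growth_equiv f (growth V).

(* Main.v *)
Require Import Defs.
From HB Require Import structures.
From mathcomp Require Import all_boot all_order all_algebra.
From mathcomp Require Import all_classical all_reals all_analysis.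
From mathcomp Require Import zify.
Import Order.TTheory GRing.Theory Num.Theory.
Import numFieldNormedType.Exports.
Set Implicit Arguments.
Unset Strict Implicit.
Unset Printing Implicit Defensive.

(* Build a minimal aperiodic bi-infinite word [x] whose complexity is [f] up to
   polynomial factors and dilation; both are absorbed by [n f(n) <= f(alpha n)].
   The algebra consists of the operators on functions [int -> k] generated by
   the shift and by multiplication by the indicator functions of the letters
   of [x] (the convolution algebra of the subshift of [x]): its growth lies
   between [p(n)] and [n p(n)], where [p] is the complexity of [x], and it is
   simple because [x] is minimal and aperiodic.
   Following Bartholdi and Smoktunowicz, [x] is assembled from sets [W n] of
   words of length [2^n] with [W (n+1) = (W n) (C n)] and [C n] a subset of
   [W n] of size about [f(2^(n+1)) / f(2^n)]. For a word [w] of [W m], a fraction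
   [1 / |W m|] of the words of [W n] begin with [w], so by condition (2) one may,
   at some later level [n], take all words of [C n] to begin with [w]; then [w]
   occurs in [x] with bounded gaps. *)

(** * Words with prescribed complexity *)

Definition subword (x : int -> nat) (i : int) (n : nat) : seq nat :=
  mkseq (fun j => x (i + j%:Z)%R) n.

Section Subword.
Variable x : int -> nat.

Lemma size_subword i n : size (subword x i n) = n.
Proof. exact: size_mkseq. Qed.

Lemma nth_subword i n j : (j < n)%N -> nth 0%N (subword x i n) j = x (i + j%:Z)%R.
Proof. exact: nth_mkseq. Qed.

Lemma subword_cat i m n :
  subword x i (m + n) = subword x i m ++ subword x (i + m%:Z)%R n.
Proof.
rewrite /subword /mkseq iotaD map_cat add0n -{2}[m]addn0 iotaDl -map_comp.
by congr (_ ++ _); apply: eq_map => j /=; rewrite PoszD addrA.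
Qed.

Lemma take_subword i m n : (m <= n)%N -> take m (subword x i n) = subword x i m.
Proof.
by move=> mn; rewrite -(subnKC mn) subword_cat take_size_cat ?size_subword.
Qed.

Lemma drop_subword i m n :
  drop m (subword x i (m + n)) = subword x (i + m%:Z)%R n.
Proof. by rewrite subword_cat drop_size_cat ?size_subword. Qed.

Lemma eq_subwordP i j n :
  subword x i n = subword x j n <->
  forall l, (l < n)%N -> x (i + l%:Z)%R = x (j + l%:Z)%R.
Proof.
split=> [e l ln|e]; first by rewrite -!(nth_subword _ ln) e.
by apply: (@eq_from_nth _ 0%N) => [|l]; rewrite !size_subword // => ln;
  rewrite !nth_subword ?e.
Qed.

End Subword.

Section Construction.
Variables (K : nat) (c : nat -> nat).
Hypothesis K_gt0 : (0 < K)%N.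
Hypothesis c_gt0 : forall n, (0 < c n)%N.

(* Every word [w] is [target n] for infinitely many [n], since [n] ranges over
   all [2 ^ pickle w * 3 ^ N]. *)
Definition target (n : nat) : seq nat := odflt [::] (unpickle (logn 2 n)).

(* The bound on the size of [target n] makes the first word of [C n.+1] end with
   the first word of [C n], so that [biword] below extends to the left. *)
Definition select (n : nat) (Wn : seq (seq nat)) : seq (seq nat) :=
  let F := [seq w <- Wn | prefix (target n) w] in
  take (c n) (if (c n <= size F) && (size (target n) <= 2 ^ n.-1) then F else Wn).

Fixpoint W (n : nat) : seq (seq nat) :=
  if n is m.+1 then [seq u ++ v | u <- W m, v <- select m (W m)]
  else [seq [:: a] | a <- iota 0 K].

Definition C n := select n (W n).

Lemma targetP (w : seq nat) N : exists2 n, (N <= n)%N & target n = w.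
Proof.
exists (2 ^ pickle w * 3 ^ N)%N.
  apply: (@leq_trans (3 ^ N)); first by rewrite ltnW // ltn_expl.
  by rewrite leq_pmull // expn_gt0.
rewrite /target lognM ?expn_gt0 // !lognX (@logn_prime 2 3) // (@logn_prime 2 2) //.
by rewrite muln0 addn0 muln1 pickleK.
Qed.

Lemma WS n : W n.+1 = [seq u ++ v | u <- W n, v <- C n].
Proof. by []. Qed.

Lemma C_sub_W n : {subset C n <= W n}.
Proof.
move=> w; rewrite /C /select => /mem_take; case: ifP => // _.
by rewrite mem_filter => /andP[].
Qed.

Lemma size_in_W n w : w \in W n -> size w = (2 ^ n)%N.
Proof.
elim: n w => [|n IH] w; first by case/mapP => a _ ->.
rewrite WS => /allpairsP[[u v] /= [uW vC ->]].
by rewrite size_cat (IH u) // (IH v) ?C_sub_W // addnn -mul2n expnS.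
Qed.

Lemma C_uniq n : uniq (W n) -> uniq (C n).
Proof.
by move=> u; rewrite /C /select take_uniq //; case: ifP; rewrite // filter_uniq.
Qed.

Lemma W_uniq n : uniq (W n).
Proof.
elim: n => [|n IH]; first by rewrite map_inj_uniq ?iota_uniq // => a b [].
rewrite WS allpairs_uniq ?C_uniq // => -[u v] [u' v'] /=.
move=> /allpairsP[[a b] /= [aW bC [-> ->]]].
move=> /allpairsP[[a' b'] /= [a'W b'C [-> ->]]] /eqP.
rewrite eqseq_cat ?(size_in_W aW) ?(size_in_W a'W) //.
by case/andP => /eqP-> /eqP->.
Qed.

Lemma W_letters n w : w \in W n -> all (fun a => a < K)%N w.
Proof.
elim: n w => [|n IH] w.
  by case/mapP => a; rewrite mem_iota => /andP[_ aK] -> /=; rewrite andbT.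
rewrite WS => /allpairsP[[u v] /= [uW vC ->]].
by rewrite all_cat (IH u) // (IH v) ?C_sub_W.
Qed.

(** The hypothesis concerns one level only, so that an induction on [n] can establish it for all
    levels while using this count. *)
Lemma size_WS_cond n : (c n <= size (W n))%N ->
  size (C n) = c n /\ size (W n.+1) = (size (W n) * c n)%N.
Proof.
move=> h; rewrite WS size_allpairs.
suff -> : size (C n) = c n by [].
by rewrite /C /select size_take_min; case: ifP => [/andP[h1 _]|_]; apply/minn_idPl.
Qed.

Hypothesis c_leW : forall n, (c n <= size (W n))%N.

Lemma size_C n : size (C n) = c n.
Proof. by case: (size_WS_cond (c_leW n)). Qed.

Lemma size_WS n : size (W n.+1) = (size (W n) * c n)%N.
Proof. by case: (size_WS_cond (c_leW n)). Qed.

Lemma W_neq0 n : (0 < size (W n))%N.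
Proof. exact: leq_trans (c_leW n). Qed.

(** * The bi-infinite word and its dyadic blocks *)

Definition left_word n := head [::] (C n).
Definition right_word n := head [::] (W n).

Lemma head_mem (T : eqType) (x : T) s : (0 < size s)%N -> head x s \in s.
Proof. by case: s => //= a s _; rewrite mem_head. Qed.

Lemma left_wordP n : left_word n \in C n.
Proof. by rewrite head_mem // size_C. Qed.

Lemma right_wordP n : right_word n \in W n.
Proof. by rewrite head_mem // W_neq0. Qed.

Lemma head_allpairs (S T U : Type) (g : S -> T -> U) a b z s t :
  (0 < size s)%N -> (0 < size t)%N ->
  head z [seq g u v | u <- s, v <- t] = g (head a s) (head b t).
Proof. by case: s t => // ? ? []. Qed.

Lemma right_wordS n : right_word n.+1 = right_word n ++ left_word n.
Proof. by rewrite /right_word WS (head_allpairs _ [::] [::]) ?W_neq0 ?size_C. Qed.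

Lemma prefix_catl (T : eqType) (t u v : seq T) :
  (size t <= size u)%N -> prefix t (u ++ v) = prefix t u.
Proof. by move=> tu; rewrite !prefixE takel_cat. Qed.

(** A prefix that fits into the first half constrains only the first factor of a product
    [u ++ v]. *)
Lemma filter_prefix_WS n t : (size t <= 2 ^ n)%N ->
  [seq w <- W n.+1 | prefix t w] =
  [seq u ++ v | u <- [seq w <- W n | prefix t w], v <- C n].
Proof.
move=> st; rewrite WS; have := @size_in_W n; elim: (W n) => //= u s IH hs.
rewrite filter_cat IH => [|w ws]; last by rewrite hs // inE ws orbT.
case: ifP => pu /=.
  congr (_ ++ _); apply/all_filterP/allP => w /mapP[v _ ->].
  have su : size u = (2 ^ n)%N by apply: hs; rewrite mem_head.
  by rewrite prefix_catl // su.
rewrite -[RHS]cat0s; congr (_ ++ _); apply/eqP; rewrite -[_ == _]negbK -has_filter.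
apply/hasPn => w /mapP[v _ ->].
have su : size u = (2 ^ n)%N by apply: hs; rewrite mem_head.
by rewrite prefix_catl ?pu // su.
Qed.

Lemma head_take (T : Type) (z : T) m s : (0 < m)%N -> head z (take m s) = head z s.
Proof. by case: m s => // m []. Qed.

(** Whether or not the words are filtered by the target, [C n.+1] starts with the head of a product
    list whose second factor runs over all of [C n]; the second half of that head is therefore the
    head of [C n]. *)
Lemma left_wordS n : exists2 u, u \in W n & left_word n.+1 = u ++ left_word n.
Proof.
rewrite {1}/left_word {1}/C /select head_take //=.
case: ifP => [/andP[h1 h2]|_]; last first.
  exists (right_word n); first exact: right_wordP.
  by rewrite -right_wordS.
have h0 := leq_trans (c_gt0 _) h1; move: h0.
rewrite filter_prefix_WS // size_allpairs muln_gt0 => /andP[h3 h4].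
exists (head [::] [seq w <- W n | prefix (target n.+1) w]).
  by have := head_mem [::] h3; rewrite mem_filter => /andP[].
by rewrite (head_allpairs _ [::] [::]).
Qed.

Lemma size_left_word n : size (left_word n) = (2 ^ n)%N.
Proof. exact/size_in_W/C_sub_W/left_wordP. Qed.

Lemma size_right_word n : size (right_word n) = (2 ^ n)%N.
Proof. exact/size_in_W/right_wordP. Qed.

(* The left half is the limit of the [left_word n], each a suffix of the next;
   the right half is the limit of the [right_word n], each a prefix of the next. *)
Definition biword (i : int) : nat :=
  match i with
  | Posz n => nth 0%N (right_word n) n
  | Negz n => nth 0%N (rev (left_word n)) n
  end.

Lemma right_word_nth n m i : (n <= m)%N -> (i < 2 ^ n)%N ->
  nth 0%N (right_word m) i = nth 0%N (right_word n) i.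
Proof.
move=> /subnKC <-; elim: (m - n)%N => [|d IH] hi; first by rewrite addn0.
rewrite addnS right_wordS nth_cat size_right_word.
by rewrite (leq_trans hi) ?leq_exp2l ?leq_addr // IH.
Qed.

Lemma left_word_nth n m i : (n <= m)%N -> (i < 2 ^ n)%N ->
  nth 0%N (rev (left_word m)) i = nth 0%N (rev (left_word n)) i.
Proof.
move=> /subnKC <-; elim: (m - n)%N => [|d IH] hi; first by rewrite addn0.
rewrite addnS; have [u _ ->] := left_wordS (n + d).
rewrite rev_cat nth_cat size_rev size_left_word.
by rewrite (leq_trans hi) ?leq_exp2l ?leq_addr // IH.
Qed.

Lemma subword_right n : subword biword 0 (2 ^ n) = right_word n.
Proof.
apply: (@eq_from_nth _ 0%N) => [|i]; rewrite size_subword ?size_right_word // => hi.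
rewrite nth_subword // add0r /=.
(* [biword] reads coordinate [i] at level [i], which may lie on either side of [n]; the words of the
   two levels agree where both are defined. *)
case: (leqP i n) => h; last by rewrite (right_word_nth (ltnW h)).
by rewrite (right_word_nth h) // ltn_expl.
Qed.

Lemma subword_left n : subword biword (- (2 ^ n)%:Z) (2 ^ n) = left_word n.
Proof.
apply: (@eq_from_nth _ 0%N) => [|i]; rewrite size_subword ?size_left_word // => hi.
rewrite nth_subword //.
have -> : (- (2 ^ n)%:Z + i%:Z)%R = Negz (2 ^ n - i.+1) by rewrite NegzE; lia.
rewrite -[in RHS](revK (left_word n)) nth_rev ?size_rev ?size_left_word //=.
set j := (2 ^ n - i.+1)%N; have jn : (j < 2 ^ n)%N by rewrite /j; lia.
case: (leqP j n) => h; last by rewrite (left_word_nth (ltnW h)).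
by rewrite -(left_word_nth h) // ltn_expl.
Qed.

Lemma subword_half y q n : subword y q (2 ^ n.+1) \in W n.+1 ->
  subword y q (2 ^ n) \in W n /\ subword y (q + (2 ^ n)%:Z) (2 ^ n) \in C n.
Proof.
rewrite expnS mul2n -addnn subword_cat WS => /allpairsP[[u v] /= [uW vC /eqP]].
by rewrite eqseq_cat ?size_subword ?(size_in_W uW) // => /andP[/eqP -> /eqP ->].
Qed.

(** Repeated halving: both halves of a block lie in [W] one level below, since [C] is a part of [W].
    The block at an odd index is the second half of a block of level [n.+1], hence lies in [C n]. *)
Lemma subword_block y n e q j : subword y q (2 ^ (n + e)) \in W (n + e) ->
  (j < 2 ^ e)%N ->
  subword y (q + (j * 2 ^ n)%N%:Z) (2 ^ n) \in W n /\
  (odd j -> subword y (q + (j * 2 ^ n)%N%:Z) (2 ^ n) \in C n).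
Proof.
elim: e q j => [|e IH] q j.
  by rewrite addn0 expn0 ltnS leqn0 => h /eqP->; rewrite mul0n addr0.
rewrite addnS => /subword_half[h1 h2] hj.
case: (ltnP j (2 ^ e)) => hj2; first exact: IH.
have hj3 : (j - 2 ^ e < 2 ^ e)%N.
  by rewrite ltn_subLR // addnn -mul2n -expnS.
have -> : (q + (j * 2 ^ n)%N%:Z = (q + (2 ^ (n + e))%:Z) + ((j - 2 ^ e) * 2 ^ n)%N%:Z)%R.
  rewrite -addrA -PoszD mulnBl -expnD (addnC e n) subnKC //.
  by rewrite addnC expnD leq_mul2r hj2 orbT.
have [h3 h4] := IH _ _ (C_sub_W h2) hj3.
(* For [e = 0] the block is itself the second half, so it lies in [C n] directly; otherwise
   subtracting the even number [2 ^ e] from the index keeps its parity. *)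
split=> // oj; case: e IH h1 h2 hj hj2 hj3 h3 h4 => [|e] _ h1 h2 hj hj2 hj3 h3 h4.
  have -> : (j - 2 ^ 0 = 0)%N by move: hj; rewrite expn0 expn1; lia.
  by move: h2; rewrite mul0n addr0 addn0.
by apply: h4; rewrite oddB // oj oddX.
Qed.

(** Aligned blocks to the right of the origin lie in some [right_word], those to the left in some
    [left_word]. In the latter the index is counted from the left end, as [2 ^ j.+1 - j.+1], which
    has the parity of [j.+1]. *)
Lemma biword_block n (j : int) :
  subword biword (j * (2 ^ n)%:Z)%R (2 ^ n) \in W n /\
  (odd `|j|%N -> subword biword (j * (2 ^ n)%:Z)%R (2 ^ n) \in C n).
Proof.
case: j => j.
  have := @subword_block biword n j 0%R j; rewrite subword_right add0r PoszM.
  by apply; rewrite ?right_wordP // ltn_expl.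
have hj : (j.+1 <= 2 ^ j.+1)%N by rewrite ltnW // ltn_expl.
have := @subword_block biword n j.+1 (- (2 ^ (n + j.+1))%:Z)%R (2 ^ j.+1 - j.+1).
rewrite subword_left (C_sub_W (left_wordP _)) => /(_ isT).
have -> : (- (2 ^ (n + j.+1))%:Z + ((2 ^ j.+1 - j.+1) * 2 ^ n)%N%:Z
   = Negz j * (2 ^ n)%:Z)%R.
  rewrite NegzE mulNr -PoszM mulnBl expnD (mulnC (2 ^ n)).
  have := leq_mul hj (leqnn (2 ^ n)); lia.
have -> : odd (2 ^ j.+1 - j.+1) = odd `|Negz j|%N by rewrite oddB // oddX.
by apply; rewrite ltn_subrL expn_gt0.
Qed.

(** Passing to the next level multiplies both the number of words beginning with [w] and the number
    of all words by the size of [C]; at level [m] only [w] itself begins with [w]. *)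
Lemma size_filter_prefix m d w : w \in W m ->
  (size [seq v <- W (m + d) | prefix w v] * size (W m) = size (W (m + d)))%N.
Proof.
move=> wW; have sw := size_in_W wW; elim: d => [|d IH].
  rewrite addn0 -[RHS]mul1n; congr (_ * _)%N; rewrite size_filter.
  rewrite (@eq_in_count _ _ (pred1 w)) ?count_uniq_mem ?W_uniq ?wW // => v vW.
  apply/idP/eqP => [|->]; last exact: prefix_refl.
  by move=> /prefixP[t ev]; move: (size_in_W vW); rewrite ev size_cat sw;
    case: t {ev} => [|? ?] /=; [rewrite cats0|lia].
rewrite addnS filter_prefix_WS ?sw ?leq_exp2l ?leq_addr //.
by rewrite size_allpairs size_WS size_C mulnAC IH.
Qed.

(** * Uniform recurrence *)

Hypothesis c_small : forall B, exists N, forall n, (N <= n)%N -> (B * c n <= size (W n))%N.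

(** At a late level [n] with target [w], the words of [W n] beginning with [w] number [size (W n)]
    divided by [size (W m)], which is at least [c n] by [c_small]; so [select] takes the filtered
    branch. *)
Lemma C_prefix m w : w \in W m -> exists n, forall v, v \in C n -> prefix w v.
Proof.
move=> wW; have sw := size_in_W wW.
have [N hN] := c_small (size (W m)).
have [n hn tn] := targetP w (maxn m.+1 N); exists n => v.
move: hn; rewrite geq_max => /andP[mn Nn].
have mn1 : (m <= n.-1)%N by lia.
rewrite /C /select tn sw leq_exp2l // mn1 andbT.
have := size_filter_prefix (n - m) wW; rewrite (subnKC (ltnW mn)) => e.
rewrite -(leq_pmul2r (W_neq0 m)) e mulnC hN //.
by move=> /mem_take; rewrite mem_filter => /andP[].
Qed.

Lemma block_index n (q : int) : exists (j : int) (o : nat),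
  (o < 2 ^ n)%N /\ q = (j * (2 ^ n)%:Z + o%:Z)%R.
Proof.
have h : ((2 ^ n)%:Z != 0 :> int)%R by rewrite eqz_nat -lt0n expn_gt0.
exists (q %/ (2 ^ n)%:Z)%Z, `|(q %% (2 ^ n)%:Z)%Z|%N.
have h0 := modz_ge0 q h; have h1 := ltz_mod q h.
split; first by lia.
by rewrite gez0_abs // -divz_eq.
Qed.

Lemma W_recurrent m w : w \in W m ->
  exists R, forall q, exists2 l, (l < R)%N & subword biword (q + l%:Z)%R (2 ^ m) = w.
Proof.
move=> wW; have [n hn] := C_prefix wW.
exists (3 * 2 ^ n)%N => q; have [j [s [hs ->]]] := block_index n q.
(* Every block of level [n] with odd index begins with [w], and one of the next two blocks after the
   one containing the given position has odd index. *)
have [i [oi [ij ji]]] : exists i : int, odd `|i|%N /\ (j < i /\ i <= j + 2)%R.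
  case: (boolP (odd `|j|%N)) => oj.
    by exists (j + 2)%R; split; lia.
  by exists (j + 1)%R; split; lia.
exists `|(i * (2 ^ n)%:Z - (j * (2 ^ n)%:Z + s%:Z))%R|%N.
  have : (i * (2 ^ n)%:Z <= (j + 2) * (2 ^ n)%:Z)%R by rewrite ler_pM2r // ltz_nat expn_gt0.
  have : ((j + 1) * (2 ^ n)%:Z <= i * (2 ^ n)%:Z)%R.
    by rewrite ler_pM2r ?ltz_nat ?expn_gt0 // lezD1.
  rewrite !mulrDl; set a := (i * _)%R; set b := (j * _)%R; lia.
have h : ((j + 1) * (2 ^ n)%:Z <= i * (2 ^ n)%:Z)%R.
  by rewrite ler_pM2r ?ltz_nat ?expn_gt0 // lezD1.
rewrite gez0_abs; last by move: h; rewrite mulrDl; lia.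
rewrite addrC subrK.
have := hn _ ((biword_block n i).2 oi); rewrite prefixE (size_in_W wW).
case: (leqP m n) => mn; first by rewrite take_subword ?leq_exp2l // => /eqP.
(* The case [n < m] is void: [w] would be a prefix of a shorter word. *)
have nm : (2 ^ n <= 2 ^ m)%N by rewrite leq_exp2l // ltnW.
rewrite take_oversize ?size_subword // => /eqP e.
have := size_in_W wW; rewrite -e size_subword => /eqP.
by rewrite eqn_exp2l // => /eqP nm'; move: mn; rewrite nm' ltnn.
Qed.

(* A trivial target makes the first words of [C N] and [W N] coincide, so the
   word around the origin is the first word of [W N.+1]. *)
Lemma center_in_W n : exists2 N, (n <= N)%N &
  subword biword (- (2 ^ N)%:Z)%R (2 ^ N.+1) \in W N.+1.
Proof.
have [N nN tN] := targetP [::] n; exists N => //.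
rewrite expnS mul2n -addnn subword_cat subword_left addrC subrr subword_right.
suff eLR : left_word N = right_word N.
  by rewrite [X in X ++ _]eLR -[X in _ ++ X]eLR -right_wordS right_wordP.
rewrite /left_word /C /select tN head_take // (eq_filter (a2 := predT)) ?filter_predT.
  by case: ifP.
by move=> w; rewrite prefix0s.
Qed.

(** For large [N] the factor sits inside the word read from [- 2 ^ N] to [2 ^ N], a word of
    [W N.+1], and recurs along with it. *)
Lemma biword_recurrent q L :
  exists R, forall q', exists2 l, (l < R)%N &
    subword biword (q' + l%:Z)%R L = subword biword q L.
Proof.
have [N hN wW] := center_in_W (`|q|%N + L).
have hN2 : (`|q|%N + L <= 2 ^ N)%N by rewrite (leq_trans hN) // ltnW // ltn_expl.
have [R hR] := W_recurrent wW.
exists (R + 2 ^ N.+1)%N => q'; have [l lR /eq_subwordP e] := hR q'.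
(* [q + 2 ^ N] is the offset of the factor inside that central word; it is nonnegative and below
   [2 ^ N.+1]. *)
exists (l + `|(q + (2 ^ N)%:Z)%R|)%N; first by rewrite expnS; lia.
apply/eq_subwordP => i iL.
have := e (`|(q + (2 ^ N)%:Z)%R| + i)%N; rewrite expnS => /(_ ltac:(lia)).
rewrite (_ : (- (2 ^ N)%:Z + _ = q + i%:Z)%R); last by lia.
by move=> <-; congr biword; lia.
Qed.

(** * Aperiodicity and the number of factors *)

Hypothesis c_gt1 : forall n, (1 < c n)%N.

Lemma size_W_ge n : (2 ^ n <= size (W n))%N.
Proof.
elim: n => [|n IH]; first exact: W_neq0.
by rewrite size_WS expnSr leq_mul.
Qed.

(** With period [e] there would be at most [e] factors of length [2 ^ e], whereas all words of [W e]
    occur and there are at least [2 ^ e] of them. *)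
Lemma biword_aperiodic e : (0 < e)%N -> exists q, biword q <> biword (q + e%:Z)%R.
Proof.
move=> e0; apply: contrapT => /forallNP he.
have per q : biword (q + e%:Z)%R = biword q by apply/esym; apply: contrapT; exact: (he q).
have pern q (j : nat) : biword (q + (j * e)%N%:Z)%R = biword q.
  elim: j => [|j IH]; first by rewrite mul0n addr0.
  by rewrite mulSn addnC PoszD addrA per.
have perz q (j : int) : biword (q + j * e%:Z)%R = biword q.
  case: j => j; first by rewrite -PoszM pern.
  have := pern (q - Posz (j.+1 * e))%R j.+1; rewrite subrK => ->.
  by congr biword; rewrite NegzE PoszM mulNr.
pose S := [seq subword biword i%:Z (2 ^ e) | i <- iota 0 e].
have : {subset W e <= S}.
  move=> w /W_recurrent[R /(_ 0%R)[l _ <-]]; apply/mapP; exists (l %% e)%N.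
    by rewrite mem_iota add0n ltn_mod.
  apply/eq_subwordP => i _.
  rewrite add0r -[RHS](pern _ (l %/ e)%N); congr biword.
  by rewrite [in LHS](divn_eq l e) PoszD -addrA addrC.
move=> /(uniq_leq_size (W_uniq e)); rewrite size_map size_iota => h.
by have := leq_trans (size_W_ge e) h; rewrite leqNgt ltn_expl.
Qed.

(** A window of length [2 ^ n] meets at most two consecutive blocks, and one of the two has odd
    index, so lies in [C n]. Pairing [W n] with [C n], in both orders, keeps the count linear in
    [size (W n.+1)]. *)
Definition factors n : seq (seq nat) :=
  [seq take (2 ^ n) (drop o w) |
    o <- iota 0 (2 ^ n),
    w <- [seq u ++ v | u <- W n, v <- C n] ++ [seq u ++ v | u <- C n, v <- W n]].

Lemma size_factors n : (size (factors n) = 2 ^ n.+1 * size (W n.+1))%N.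
Proof.
rewrite (size_WS n) size_allpairs size_iota size_cat !size_allpairs size_C expnS; lia.
Qed.

Lemma subword_factors n q : subword biword q (2 ^ n) \in factors n.
Proof.
have [j [s [hs ->]]] := block_index n q.
apply/allpairsP; exists (s, subword biword (j * (2 ^ n)%:Z)%R (2 ^ n + 2 ^ n)).
split; first by rewrite mem_iota.
  rewrite /= subword_cat mem_cat.
  have [h1 h2] := biword_block n j.
  have := biword_block n (j + 1)%R; rewrite mulrDl mul1r => -[h3 h4].
  apply/orP; case: (boolP (odd `|j|%N)) => oj; [right|left]; apply/allpairsP.
    by exists (subword biword (j * (2 ^ n)%:Z)%R (2 ^ n),
      subword biword (j * (2 ^ n)%:Z + (2 ^ n)%:Z)%R (2 ^ n)); split=> //=; apply: h2.
  exists (subword biword (j * (2 ^ n)%:Z)%R (2 ^ n),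
      subword biword (j * (2 ^ n)%:Z + (2 ^ n)%:Z)%R (2 ^ n)); split=> //=; apply: h4.
  by move: oj; lia.
rewrite /= (_ : (2 ^ n + 2 ^ n = s + (2 ^ n + (2 ^ n - s)))%N); last by lia.
by rewrite drop_subword take_subword // leq_addr.
Qed.

Lemma biword_lt i : (biword i < K)%N.
Proof.
have := (biword_block 0 i).1; rewrite mulr1 => /W_letters /=.
by rewrite /subword /= addr0 andbT.
Qed.

End Construction.

Local Open Scope classical_set_scope.
Local Open Scope ring_scope.

(** * Dimensions of subspaces *)

Section Span.
Variables (k : fieldType) (M : lmodType k).
Implicit Types (U X Y : set M).

Lemma linear_subspaceP U : linear_subspace U <->
  U 0 /\ (forall a u v, U u -> U v -> U (a *: u + v)).
Proof.
split=> -[h0 h1]; split.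
- by move: h0; rewrite inE.
- by move=> a u v hu hv; have := h1 a u v; rewrite !inE; apply.
- by rewrite inE.
- by move=> a u v; rewrite !inE; exact: h1.
Qed.

Lemma subspace0 U : linear_subspace U -> U 0.
Proof. by case/linear_subspaceP. Qed.

Lemma subspaceZ U a u : linear_subspace U -> U u -> U (a *: u).
Proof. by case/linear_subspaceP => h0 h1 hu; rewrite -[_ *: _]addr0; apply: h1. Qed.

Lemma subspaceD U u v : linear_subspace U -> U u -> U v -> U (u + v).
Proof. by case/linear_subspaceP => h0 h1 hu hv; rewrite -[u]scale1r; apply: h1. Qed.

Lemma subspace_sum U (I : Type) (r : seq I) (P : pred I) (g : I -> M) :
  linear_subspace U -> (forall i, P i -> U (g i)) -> U (\sum_(i <- r | P i) g i).
Proof.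
move=> hU hg; elim/big_ind: _ => //; first exact: subspace0.
by move=> u v; exact: subspaceD.
Qed.

Lemma subspace_sum_seq U (I : eqType) (r : seq I) (g : I -> M) :
  linear_subspace U -> (forall i, i \in r -> U (g i)) -> U (\sum_(i <- r) g i).
Proof. by move=> hU hg; rewrite big_seq; exact: subspace_sum. Qed.

Lemma linear_span_subspace X : linear_subspace (linear_span X).
Proof.
apply/linear_subspaceP; split=> [U [hU _]|a u v hu hv U hUX].
  exact: subspace0.
by have /linear_subspaceP[_] := hUX.1; apply; [apply: hu|apply: hv].
Qed.

Lemma sub_linear_span X : X `<=` linear_span X.
Proof. exact: sub_gen_smallest. Qed.

Lemma linear_span_sub X U : linear_subspace U -> X `<=` U -> linear_span X `<=` U.
Proof. exact: smallest_sub. Qed.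

Lemma linear_span_mono X Y : X `<=` Y -> linear_span X `<=` linear_span Y.
Proof.
move=> XY; apply: linear_span_sub; first exact: linear_span_subspace.
exact: subset_trans XY (@sub_linear_span Y).
Qed.

Lemma linear_span_rangeP d (e : 'I_d -> M) u :
  linear_span (range e) u <-> exists c : 'I_d -> k, u = \sum_i c i *: e i.
Proof.
have hS := linear_span_subspace (range e).
split=> [|[c ->]]; last first.
  apply: (subspace_sum _ hS) => i _; apply: (subspaceZ _ hS).
  by apply: sub_linear_span; exists i.
pose S := [set v | exists c : 'I_d -> k, v = \sum_i c i *: e i].
suff : linear_span (range e) `<=` S by apply.
apply: linear_span_sub => [|_ [i _ <-]].
  apply/linear_subspaceP; split.
    by exists (fun=> 0); rewrite big1 // => i _; rewrite scale0r.
  move=> a _ _ [c ->] [c' ->]; exists (fun i => a * c i + c' i).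
  rewrite scaler_sumr -big_split /=; apply: eq_bigr => i _.
  by rewrite scalerDl scalerA.
exists (fun j => (j == i)%:R); rewrite (bigD1 i) //= eqxx scale1r big1 ?addr0 //.
by move=> j /negbTE->; rewrite scale0r.
Qed.

(** If [d > m], the matrix of coefficients of [e] in terms of [g] has a nonzero left kernel vector,
    which is a linear relation between the [e i]. *)
Lemma steinitz d m (e : 'I_d -> M) (g : 'I_m -> M) :
  lin_indep e -> range e `<=` linear_span (range g) -> (d <= m)%N.
Proof.
move=> he heg.
have /choice[a ha] : forall i, exists c : 'I_m -> k, e i = \sum_j c j *: g j.
  by move=> i; apply/linear_span_rangeP; apply: heg; exists i.
pose B := \matrix_(i < d, j < m) a i j.
rewrite leqNgt; apply/negP => md.
have kB : kermx B != 0.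
  by rewrite -mxrank_eq0 mxrank_ker -lt0n subn_gt0 (leq_ltn_trans (rank_leq_col B)).
have /rowV0Pn[v /sub_kermxP vB v0] := kB.
case/eqP: v0; apply/rowP => i; rewrite mxE.
apply: (he (fun i => v 0 i)).
under eq_bigr => j _ do rewrite ha scaler_sumr.
rewrite exchange_big /= big1 // => j _.
have /rowP/(_ j) := vB; rewrite !mxE => vBj.
under eq_bigr => l _ do rewrite scalerA.
rewrite -scaler_suml; suff -> : \sum_i v 0 i * a i j = 0 by rewrite scale0r.
by rewrite -[RHS]vBj; apply: eq_bigr => l _; rewrite mxE.
Qed.

Lemma lin_indep_extend U d (e : 'I_d -> M) u : lin_indep e ->
  ~ linear_span (range e) u ->
  lin_indep (fun i : 'I_d.+1 => oapp e u (unlift ord_max i)).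
Proof.
move=> he hu c hc.
have hc' : c ord_max *: u + \sum_i c (lift ord_max i) *: e i = 0.
  rewrite -[RHS]hc (bigD1_ord ord_max) //= unlift_none /=; congr (_ + _).
  by apply: eq_bigr => i _; rewrite liftK.
have c0 : c ord_max = 0.
  apply/eqP/negPn/negP => c0; apply: hu; apply/linear_span_rangeP.
  exists (fun i => - (c ord_max)^-1 * c (lift ord_max i)).
  apply: (scalerI c0); apply/eqP; rewrite -subr_eq0; apply/eqP.
  rewrite -[RHS]hc' scaler_sumr -sumrN; congr (_ + _); apply: eq_bigr => i _.
  by rewrite scalerA mulrA mulrN mulfV // mulN1r scaleNr opprK.
move: hc'; rewrite c0 scale0r add0r => /he hc' i.
by case: (unliftP ord_max i) => [j|] ->.
Qed.

(** By [steinitz] independent families in [U] have at most [m] members; one of maximal size spans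
    [U], as it could be extended otherwise. *)
Lemma has_dim_exists U m (g : 'I_m -> M) : linear_subspace U ->
  U `<=` linear_span (range g) -> exists d, has_dim U d.
Proof.
move=> hU hUg.
pose P d := `[< exists2 e : 'I_d -> M, lin_indep e & range e `<=` U >].
have P0 : exists d, P d.
  exists 0%N; apply/asboolP; exists (fun=> 0); first by move=> c _ i; have := ltn_ord i.
  by move=> u [i _ _]; have := ltn_ord i.
have Pm d : P d -> (d <= m)%N.
  move=> /asboolP[e he heU]; apply: steinitz he _; exact: subset_trans heU hUg.
case: (ex_maxnP P0 Pm) => d /asboolP[e he heU] dmax; exists d, e; split=> //.
apply/seteqP; split; first exact: linear_span_sub.
move=> u Uu; apply: contrapT => hu.
have := dmax d.+1; rewrite ltnn => /(_ _)/notF; apply; apply/asboolP.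
exists (fun i : 'I_d.+1 => oapp e u (unlift ord_max i)).
  exact: lin_indep_extend.
by move=> _ [i _ <-]; case: unliftP => [j|] _ //=; apply: heU; exists j.
Qed.

(** The finite family [g] rules out the junk value of [subspace_dim]; the dimension estimates below
    carry such a family for the same purpose. *)
Lemma subspace_dimP U m (g : 'I_m -> M) : linear_subspace U ->
  U `<=` linear_span (range g) -> has_dim U (subspace_dim U).
Proof.
move=> hU hUg; have [d hd] := has_dim_exists hU hUg.
by rewrite /subspace_dim; case: xgetP => [? _ //|/(_ d)].
Qed.

Lemma subspace_dim_le U m (g : 'I_m -> M) : linear_subspace U ->
  U `<=` linear_span (range g) -> (subspace_dim U <= m)%N.
Proof.
move=> hU hUg; have [e [he eU]] := subspace_dimP hU hUg.
have := sub_linear_span (X := range e); rewrite eU => h.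
exact: steinitz he (subset_trans h hUg).
Qed.

Lemma subspace_dim_ge U m (g : 'I_m -> M) d (e : 'I_d -> M) : linear_subspace U ->
  U `<=` linear_span (range g) -> lin_indep e -> range e `<=` U ->
  (d <= subspace_dim U)%N.
Proof.
move=> hU hUg he heU; have [b [hb bU]] := subspace_dimP hU hUg.
by apply: (steinitz (g := b) he); rewrite bU.
Qed.

Lemma subspace_dim_mono U V m (g : 'I_m -> M) :
  linear_subspace U -> linear_subspace V -> V `<=` linear_span (range g) ->
  U `<=` V -> (subspace_dim U <= subspace_dim V)%N.
Proof.
move=> hU hV hVg UV; have [e [he eU]] := subspace_dimP hU (subset_trans UV hVg).
have := sub_linear_span (X := range e); rewrite eU => h.
exact: subspace_dim_ge hV hVg he (subset_trans h UV).
Qed.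

End Span.

(** * Powers of a generating subspace *)

Section Powers.
Variables (k : fieldType) (A : algType k).
Implicit Types (V : set A).

Lemma subalgebraP (X : set A) : subalgebra X <->
  [/\ X 1, linear_subspace X & forall a b, X a -> X b -> X (a * b)].
Proof.
split=> [[h0 h1 h2]|[h0 h1 h2]].
  have X1 : X 1 by move: h0; rewrite inE.
  have XL a u v : X u -> X v -> X (a *: u + v).
    by move=> hu hv; have := h1 a u v; rewrite !inE; apply.
  split=> //.
    apply/linear_subspaceP; split=> //.
    (* Closure under subalgebra operations does not list 0; it is obtained as [-1 *: 1 + 1]. *)
    by have := XL (-1) 1 1 X1 X1; rewrite scaleN1r addNr.
  by move=> a b ha hb; have := h2 a b; rewrite !inE; apply.
have [h3 h4] := (linear_subspaceP X).1 h1.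
split; first by rewrite inE.
  by move=> a u v; rewrite !inE; exact: h4.
by move=> a b; rewrite !inE; exact: h2.
Qed.

Lemma subspace_power_subspace V n : linear_subspace (subspace_power V n).
Proof. exact: linear_span_subspace. Qed.

Lemma subspace_power_prod V n (v : 'I_n -> A) :
  (forall i, V (v i)) -> subspace_power V n (\prod_i v i).
Proof. by move=> hv; apply: sub_linear_span; exists v. Qed.

Lemma subspace_powerM V m n a b :
  subspace_power V m a -> subspace_power V n b -> subspace_power V (m + n) (a * b).
Proof.
move=> ha; move: b; suff : subspace_power V n `<=` [set b | subspace_power V (m + n) (a * b)].
  by apply.
have hS := subspace_power_subspace V (m + n).
apply: linear_span_sub.
  apply/linear_subspaceP; split=> [|c u v /= hu hv]; first by rewrite /= mulr0; exact: subspace0.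
  by rewrite /= mulrDr -scalerAr; apply: (subspaceD hS) => //; exact: (subspaceZ _ hS).
move=> _ [v hv <-] /=; move: a ha.
suff : subspace_power V m `<=`
    [set a | subspace_power V (m + n) (a * \prod_i v i)] by apply.
apply: linear_span_sub.
  apply/linear_subspaceP; split=> [|c u w /= hu hw]; first by rewrite /= mul0r; exact: subspace0.
  by rewrite /= mulrDl -scalerAl; apply: (subspaceD hS) => //; exact: (subspaceZ _ hS).
move=> _ [w hw <-] /=.
have -> : \prod_i w i * \prod_i v i = \prod_(i < m + n)
    match fintype.split i with inl j => w j | inr j => v j end.
  rewrite big_split_ord /=; congr (_ * _); apply: eq_bigr => i _.
    by rewrite (unsplitK (inl i)).
  by rewrite (unsplitK (inr i)).
apply: subspace_power_prod => i; case: fintype.splitP => j _; [exact: hw|exact: hv].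
Qed.

Lemma subspace_power_mono V m n : V 1 -> (m <= n)%N ->
  subspace_power V m `<=` subspace_power V n.
Proof.
move=> V1 /subnKC <- a ha; rewrite -[a]mulr1; apply: subspace_powerM => //.
have <- : \prod_(i < n - m) (1 : A) = 1 by rewrite big1.
exact: subspace_power_prod.
Qed.

Lemma subspace_power1 V a : V a -> subspace_power V 1 a.
Proof.
move=> Va; have <- : \prod_(i < 1) a = a by rewrite big_ord1.
exact: subspace_power_prod.
Qed.

(** The union of the powers of [V] is a subalgebra containing [V]; it is closed under sums because
    the powers increase when 1 lies in [V]. *)
Lemma generating_power V : V 1 -> generated_subalgebra V = setT ->
  forall a, exists n, subspace_power V n a.
Proof.
move=> V1 hV; pose S := [set a | exists n, subspace_power V n a].
suff : generated_subalgebra V `<=` S by rewrite hV => h a; apply: h.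
apply: smallest_sub => [|a Va]; last by exists 1%N; exact: subspace_power1.
apply/subalgebraP; split; first by exists 1%N; exact: subspace_power1.
  apply/linear_subspaceP; split.
    by exists 0%N; exact: subspace0 (subspace_power_subspace V 0).
  move=> c u v [m hu] [n hv]; exists (m + n)%N.
  have hS := subspace_power_subspace V (m + n).
  apply: (subspaceD hS).
    by apply: (subspaceZ _ hS); exact: (subspace_power_mono V1 (leq_addr _ _)) hu.
  exact: (subspace_power_mono V1 (leq_addl _ _)) hv.
by move=> u v [m hu] [n hv]; exists (m + n)%N; exact: subspace_powerM.
Qed.

Lemma generating_power_uniform V (s : seq A) : V 1 -> generated_subalgebra V = setT ->
  exists2 n, (0 < n)%N & forall a, a \in s -> subspace_power V n a.
Proof.
move=> V1 hV; elim: s => [|a s [n n0 IH]]; first by exists 1%N.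
have [m hm] := generating_power V1 hV a.
exists (m + n)%N; first by rewrite addn_gt0 n0 orbT.
move=> b; rewrite inE => /predU1P[->|/IH hb].
  exact: (subspace_power_mono V1 (leq_addr _ _)) hm.
exact: (subspace_power_mono V1 (leq_addl _ _)) hb.
Qed.

End Powers.

(** * Local operators *)

Definition agree (T : Type) (N : nat) (y z : int -> T) (i j : int) : Prop :=
  forall d : int, (`|d|%N <= N)%N -> y (i + d) = z (j + d).

Section Agree.
Variables (T : Type).
Implicit Types (y z : int -> T).

Lemma agreeW m n y z i j : (m <= n)%N -> agree n y z i j -> agree m y z i j.
Proof. by move=> mn h d dm; apply: h; exact: leq_trans mn. Qed.

Lemma agree_shift m n y z i j d : (`|d|%N <= m)%N ->
  agree (m + n) y z i j -> agree n y z (i + d) (j + d).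
Proof. by move=> dm h e en; rewrite -!addrA; apply: h; lia. Qed.

Lemma agree0 n y z i j : agree n y z i j -> y i = z j.
Proof. by move=> h; rewrite -[i]addr0 -[j]addr0; apply: h. Qed.

Lemma agree_sym n y z i j : agree n y z i j -> agree n z y j i.
Proof. by move=> h d /h. Qed.

Lemma agree_trans n y1 y2 y3 i1 i2 i3 :
  agree n y1 y2 i1 i2 -> agree n y2 y3 i2 i3 -> agree n y1 y3 i1 i3.
Proof. by move=> h1 h2 d dn; rewrite h1 ?h2. Qed.
End Agree.

Lemma agree_subword n (x : int -> nat) i j :
  agree n x x i j <->
  subword x (i - n%:Z) n.*2.+1 = subword x (j - n%:Z) n.*2.+1.
Proof.
split=> [h|/eq_subwordP h d dn].
  apply/eq_subwordP => l ln; rewrite -!addrA; apply: h; lia.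
have := h (absz (d + n%:Z)); rewrite (_ : Posz (absz (d + n%:Z)) = n%:Z + d); last by lia.
by rewrite !addrA !subrK; apply; lia.
Qed.

Section LocalOperators.
Variables (k : fieldType) (x : int -> nat).
Local Notation op := ((int -> k^o) -> (int -> k^o)).

(* [i <> j] is allowed: the rule computing [F u i] from [u] near [i] is determined
   by the pattern of [x] around [i]. *)
Definition local (N : nat) (F : op) : Prop :=
  (forall a u v, F (a *: u + v) = a *: F u + F v) /\
  (forall i j u v, agree N x x i j -> agree N u v i j -> F u i = F v j).

Lemma local_mono m n F : (m <= n)%N -> local m F -> local n F.
Proof.
move=> mn [hl h]; split=> // i j u v h1 h2.
by apply: h; [exact: agreeW h1|exact: agreeW h2].
Qed.

Lemma local_id : local 0 id.
Proof. by split=> // i j u v _ /agree0. Qed.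

Lemma local_comp m n F G : local m F -> local n G -> local (m + n) (F \o G).
Proof.
move=> [lF hF] [lG hG]; split=> [a u v /=|i j u v xij uv /=]; first by rewrite lG lF.
apply: hF; first exact: agreeW (leq_addr _ _) xij.
by move=> d dm; apply: hG; exact: agree_shift dm _.
Qed.

Lemma local_lin N a F G : local N F -> local N G -> local N (a *: F + G).
Proof.
move=> [lF hF] [lG hG]; split=> [b u v|i j u v xij uv].
  rewrite /GRing.add/=/GRing.scale/= lF lG; apply/funext => i.
  rewrite !fctE /= !scalerDr !scalerA (mulrC a b) -!addrA; congr (_ + _).
  by rewrite addrCA.
by rewrite !fctE /= (hF i j u v) // (hG i j u v).
Qed.

Lemma local0 N : local N 0.
Proof.
by rewrite (_ : 0 = (fun=> 0) :> op) //; split=> // a u v; rewrite scaler0 addr0.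
Qed.

Definition is_local : {pred op} := [pred F | `[< exists N, local N F >]].

Lemma is_local_closed : GRing.subsemimod_closed is_local.
Proof.
have h0 : 0 \in is_local by apply/asboolP; exists 0%N; exact: local0.
have h1 a F G : F \in is_local -> G \in is_local -> a *: F + G \in is_local.
  move=> /asboolP[m hF] /asboolP[n hG]; apply/asboolP; exists (m + n)%N.
  by apply: local_lin; [apply: local_mono hF|apply: local_mono hG];
    rewrite ?leq_addr ?leq_addl.
split; first split=> //.
  by move=> F G hF hG; rewrite -[F]scale1r; exact: h1.
by move=> a F hF; rewrite -[_ *: _]addr0; exact: h1.
Qed.

(** The algebra of the theorem, with composition as product. Defining it by locality makes
    membership easy to test; that shifts and letters generate it is shown in
    [locop_finitely_generated]. *)
Record locop := Locop { locop_fun :> op; _ : locop_fun \in is_local }.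

HB.instance Definition _ := [isSub for locop_fun].
HB.instance Definition _ := [Choice of locop by <:].
HB.instance Definition _ :=
  GRing.SubChoice_isSubLmodule.Build k _ _ locop is_local_closed.

Definition mk_locop N F (h : local N F) : locop := Locop (asboolT (ex_intro _ N h)).

Lemma locopP (F : locop) : exists N, local N F.
Proof. by case: F => F /= /asboolP. Qed.

Lemma locop_eq (F G : locop) : (forall u i, F u i = G u i) -> F = G.
Proof. by move=> h; apply/val_inj/funext => u; apply/funext => i; exact: h. Qed.

Lemma locop_mul_subproof (F G : locop) : (F : op) \o G \in is_local.
Proof.
have [m hF] := locopP F; have [n hG] := locopP G.
by apply/asboolP; exists (m + n)%N; exact: local_comp.
Qed.

Definition locop_mul (F G : locop) : locop := Locop (locop_mul_subproof F G).
Definition locop_one : locop := mk_locop local_id.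

Lemma locopD (F G : locop) u i : (F + G : locop) u i = F u i + G u i.
Proof. by []. Qed.

Lemma locopN (F : locop) u i : (- F : locop) u i = - F u i.
Proof. by []. Qed.

Lemma locopZ (a : k) (F : locop) u i : (a *: F : locop) u i = a * F u i.
Proof. by []. Qed.

Lemma locop0 u i : (0 : locop) u i = 0.
Proof. by []. Qed.

Lemma locop_linear (F : locop) a u v : F (a *: u + v) = a *: F u + F v.
Proof. by have [N []] := locopP F. Qed.

Lemma locop_add (F : locop) u v : F (u + v) = F u + F v.
Proof. by have := locop_linear F 1 u v; rewrite !scale1r. Qed.

Lemma locop_zero (F : locop) : F 0 = 0.
Proof. by have := locop_linear F (-1) 0 0; rewrite scaler0 addr0 scaleN1r addNr. Qed.

Lemma locop_scale (F : locop) a u : F (a *: u) = a *: F u.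
Proof. by have := locop_linear F a u 0; rewrite locop_zero !addr0. Qed.

Lemma locop_mulA : associative locop_mul.
Proof. by move=> F G H; apply: locop_eq. Qed.

Lemma locop_mul1 : left_id locop_one locop_mul.
Proof. by move=> F; apply: locop_eq. Qed.

Lemma locop_mul_one : right_id locop_one locop_mul.
Proof. by move=> F; apply: locop_eq. Qed.

Lemma locop_mulDl : left_distributive locop_mul +%R.
Proof. by move=> F G H; apply: locop_eq. Qed.

Lemma locop_mulDr : right_distributive locop_mul +%R.
Proof.
move=> F G H; apply: locop_eq => u i.
exact: (congr1 (@^~ i) (locop_add F (G u) (H u))).
Qed.

Lemma locop_one_neq0 : locop_one != 0.
Proof.
apply/eqP => h; have : locop_one (fun=> 1) 0 = (0 : locop) (fun=> 1) 0 by rewrite h.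
by rewrite locop0 /= => /eqP; rewrite oner_eq0.
Qed.

HB.instance Definition _ := GRing.Zmodule_isNzRing.Build locop locop_mulA
  locop_mul1 locop_mul_one locop_mulDl locop_mulDr locop_one_neq0.

Lemma locop_scaleAl (a : k) (F G : locop) : a *: (F * G) = (a *: F) * G.
Proof. by apply: locop_eq. Qed.

HB.instance Definition _ := GRing.Lmodule_isLalgebra.Build k locop locop_scaleAl.

Lemma locop_scaleAr (a : k) (F G : locop) : a *: (F * G) = F * (a *: G).
Proof.
apply: locop_eq => u i; exact: (congr1 (@^~ i) (esym (locop_scale F a (G u)))).
Qed.

HB.instance Definition _ := GRing.Lalgebra_isAlgebra.Build k locop locop_scaleAr.

Lemma locopM (F G : locop) u : (F * G : locop) u = F (G u).
Proof. by []. Qed.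

Lemma local_translate (d : int) : local `|d|%N (fun u i => u (i + d)).
Proof. by split=> // i j u v _; apply; exact: leqnn. Qed.

Definition translate d := mk_locop (local_translate d).

Lemma local_diag N (P : int -> bool) :
  (forall i j, agree N x x i j -> P i = P j) ->
  local N (fun u i => if P i then u i else 0).
Proof.
move=> hP; split=> [a u v|i j u v /hP-> /agree0-> //].
apply/funext => i; rewrite !fctE /=; case: ifP => // _.
by rewrite scaler0 addr0.
Qed.

Lemma letter_subproof a i j : agree 0 x x i j -> (x i == a) = (x j == a).
Proof. by move=> /agree0->. Qed.

Definition letter a := mk_locop (local_diag (@letter_subproof a)).

Lemma cylinder_subproof w i j : agree (size w) x x i j ->
  (subword x i (size w) == w) = (subword x j (size w) == w).
Proof.
by move=> h; congr (_ == _); apply/eq_subwordP => l ln; apply: h; rewrite ltnW.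
Qed.

Definition cylinder w := mk_locop (local_diag (@cylinder_subproof w)).

Lemma returns_subproof N i0 i j : agree N x x i j ->
  `[< agree N x x i i0 >] = `[< agree N x x j i0 >].
Proof.
move=> h; apply/asboolP/asboolP; first exact/agree_trans/agree_sym.
exact: agree_trans.
Qed.

Definition returns N i0 := mk_locop (local_diag (@returns_subproof N i0)).

Definition delta_fun (j : int) : int -> k^o := fun i => (i == j)%:R.

End LocalOperators.

(** * Generators, spanning families and growth bounds *)

Section Structure.
Variables (k : fieldType) (x : int -> nat).
Local Notation locop := (locop k x).
Local Notation delta := (@delta_fun k).
Local Notation translate := (@translate k x).
Local Notation cylinder := (@cylinder k x).
Local Notation letter := (@letter k x).

Lemma locop_sum (F : locop) (I : Type) (r : seq I) (c : I -> k) (g : I -> int -> k^o) :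
  F (\sum_(l <- r) c l *: g l) = \sum_(l <- r) c l *: F (g l).
Proof.
by elim: r => [|l r IH]; rewrite ?big_nil ?locop_zero // !big_cons locop_linear IH.
Qed.

(** On the window of radius [N] around [i] the function [u] agrees with a finite combination of
    delta functions, and [F u i] depends on nothing else. The numbers [F (delta j) i] are the matrix
    entries of [F]. *)
Lemma local_expand N (F : locop) u i : local x N F ->
  F u i = \sum_(0 <= l < N.*2.+1) u (i - N%:Z + l%:Z) * F (delta (i - N%:Z + l%:Z)) i.
Proof.
move=> [_ hF].
pose v : int -> k^o :=
  \sum_(0 <= l < N.*2.+1) u (i - N%:Z + l%:Z) *: delta (i - N%:Z + l%:Z).
have sE (a : k) (g : int -> k^o) j : (a *: g) j = a * g j by [].
have uv : agree N u v i i.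
  move=> d dN; rewrite /v fct_sumE /=.
  rewrite (bigD1_seq (absz (d + N%:Z))) ?iota_uniq ?mem_index_iota //=; last by lia.
  rewrite (_ : i - N%:Z + Posz (absz (d + N%:Z)) = i + d); last by lia.
  rewrite sE /delta_fun eqxx mulr1 big1 ?addr0 // => l ld; rewrite sE.
  rewrite (_ : (_ == _) = false) ?mulr0 //; apply/eqP; lia.
by rewrite (hF i i u v) //= /v locop_sum fct_sumE.
Qed.

Lemma translateM d e : translate d * translate e = translate (d + e).
Proof. by apply: locop_eq => u i; rewrite locopM /= addrA. Qed.

Lemma translate0 : translate 0 = 1.
Proof. by apply: locop_eq => u i /=; rewrite addr0. Qed.

Lemma band_elementE N w l u i : size w = N.*2.+1 ->
  (translate (- N%:Z) * cylinder w * translate l%:Z : locop) u i =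
  if subword x (i - N%:Z) N.*2.+1 == w then u (i - N%:Z + l%:Z) else 0.
Proof. by move=> sw; rewrite !locopM /= sw. Qed.

(** The element for [w] and [l] reads its argument at offset [l - N] wherever the window of radius
    [N] shows [w], and gives 0 elsewhere. *)
Definition band (L : seq (seq nat)) N : seq locop :=
  [seq translate (- N%:Z) * cylinder w * translate l%:Z | w <- L, l <- iota 0 N.*2.+1].

(** By locality a matrix entry depends only on the offset from the diagonal and on the word in the
    window, so [F] is the combination of band elements with these entries as coefficients. *)
Lemma local_span N (L : seq (seq nat)) (F : locop) :
  (forall i, subword x i N.*2.+1 \in L) -> local x N F ->
  linear_span [set` band L N] F.
Proof.
move=> hL hF.
(* [p w] is the centre of one occurrence of [w]. The default 0 for a word that does not occur is
   harmless, since the band element of such a word vanishes. *)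
pose p w := xget 0 [set i : int | subword x (i - N%:Z) N.*2.+1 = w].
pose L' := [seq w <- undup L | size w == N.*2.+1].
have hS := linear_span_subspace [set` band L N].
pose c w l : k := F (delta (p w - N%:Z + l%:Z)) (p w).
suff -> : F = \sum_(w <- L') \sum_(0 <= l < N.*2.+1)
    c w l *: (translate (- N%:Z) * cylinder w * translate l%:Z).
  apply: (subspace_sum_seq hS) => w; rewrite mem_filter mem_undup => /andP[_ wL].
  apply: (subspace_sum_seq hS) => l; rewrite mem_index_iota => /andP[_ lN].
  apply: (subspaceZ _ hS); apply: sub_linear_span => /=.
  by apply/allpairsP; exists (w, l); rewrite mem_iota.
apply: locop_eq => u i; rewrite (local_expand _ _ hF).
have sumE (I : Type) (r : seq I) (G : I -> locop) :
    (\sum_(j <- r) G j : locop) u i = \sum_(j <- r) G j u i.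
  by elim: r => [|j r IH]; rewrite ?big_nil // !big_cons locopD IH.
rewrite sumE.
set wi := subword x (i - N%:Z) N.*2.+1.
have wiL : wi \in L' by rewrite mem_filter mem_undup hL size_subword eqxx.
rewrite (bigD1_seq wi) ?filter_uniq ?undup_uniq //= [X in _ = _ + X]big1_seq ?addr0.
  rewrite sumE; apply: eq_big_nat => l lN.
  rewrite locopZ band_elementE ?size_subword // eqxx mulrC; congr (_ * _).
  have pw : subword x (p wi - N%:Z) N.*2.+1 = wi.
    by rewrite /p; case: xgetP => [j _ //|/(_ i) h]; case: h.
  rewrite /c; have [_] := hF; apply; first exact/agree_subword.
  move=> d _; rewrite /delta_fun; congr ((nat_of_bool _)%:R); apply/eqP/eqP; lia.
move=> w /andP[wi_neq]; rewrite mem_filter => /andP[/eqP sw _].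
rewrite sumE big1 // => l _; rewrite locopZ band_elementE //.
by rewrite eq_sym (negbTE wi_neq) mulr0.
Qed.

Lemma cylinder_nil : cylinder [::] = 1.
Proof. by apply: locop_eq. Qed.

(** One more letter costs three generators, so cylinders have length linear in the word; hence the
    constant 3 in the growth bounds. *)
Lemma cylinder_cons a w : cylinder (a :: w) = letter a * translate 1 * cylinder w * translate (-1).
Proof.
apply: locop_eq => u i; rewrite !locopM /= addrK.
rewrite -[(size w).+1]add1n subword_cat {1}/subword /= addr0 eqseq_cons.
by case: eqP.
Qed.

Variable K : nat.
Hypothesis xK : forall i, (x i < K)%N.

Definition generators : seq locop :=
  [:: translate 1; translate (-1)] ++ [seq letter a | a <- iota 0 K].

Lemma letter_out a : (K <= a)%N -> letter a = 0.
Proof.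
move=> Ka; apply: locop_eq => u i /=; case: eqP => // e.
by have := xK i; rewrite e ltnNge Ka.
Qed.

Lemma subalgebra_letter (X : set locop) a : subalgebra X -> [set` generators] `<=` X ->
  X (letter a).
Proof.
move=> /subalgebraP[_ hX _] gX; case: (ltnP a K) => aK; last first.
  by rewrite letter_out //; exact: subspace0.
apply: gX; rewrite /= mem_cat; apply/orP; right; apply: map_f.
by rewrite mem_iota.
Qed.

Lemma subalgebra_translate (X : set locop) d : subalgebra X -> [set` generators] `<=` X ->
  X (translate d).
Proof.
move=> /subalgebraP[X1 _ XM] gX.
have h n : X (translate n%:Z).
  elim: n => [|n IH]; first by rewrite translate0.
  by rewrite -addn1 PoszD -translateM; apply: (XM) => //; apply: gX; rewrite /= inE eqxx.
have h' n : X (translate (- n%:Z)).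
  elim: n => [|n IH]; first by rewrite oppr0 translate0.
  rewrite -addn1 PoszD opprD -translateM; apply: (XM) => //; apply: gX.
  by rewrite /= !inE eqxx orbT.
by case: d => n; rewrite ?NegzE.
Qed.

Lemma subalgebra_cylinder (X : set locop) w : subalgebra X -> [set` generators] `<=` X ->
  X (cylinder w).
Proof.
move=> hX gX; have [X1 _ XM] := (subalgebraP X).1 hX.
elim: w => [|a w IH]; first by rewrite cylinder_nil.
rewrite cylinder_cons; apply: (XM); last exact: subalgebra_translate.
apply: (XM) => //; apply: (XM); first exact: subalgebra_letter.
exact: subalgebra_translate.
Qed.

(** A crude list of all words over [K] letters, for use where only finiteness matters. *)
Lemma subword_list n : exists L : seq (seq nat), forall i, subword x i n \in L.
Proof.
exists [seq [seq nat_of_ord j | j <- tval t] | t <- enum {: n.-tuple 'I_K}].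
move=> i; apply/mapP.
exists [tuple Ordinal (xK (i + (j : 'I_n)%:Z)) | j < n]; first by rewrite mem_enum.
rewrite /= -map_comp /= /subword /mkseq -val_enum_ord -map_comp.
by rewrite map_comp; congr map.
Qed.

Lemma locop_finitely_generated : finitely_generated locop.
Proof.
exists generators; apply/seteqP; split=> // F _ X [hX gX].
have [_ lX XM] := (subalgebraP X).1 hX.
have [N hF] := locopP F.
have [L hL] := subword_list N.*2.+1.
have : linear_span [set` band L N] `<=` X.
  apply: linear_span_sub => // _ /allpairsP[[w l] /= [_ _ ->]].
  apply: (XM); last exact: subalgebra_translate.
  by apply: (XM); [exact: subalgebra_translate|exact: subalgebra_cylinder].
by apply; exact: local_span.
Qed.

Lemma cylinder_power (V : set locop) c w : V 1 ->
  (forall g, g \in generators -> subspace_power V c g) ->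
  subspace_power V ((3 * c) * size w) (cylinder w).
Proof.
move=> V1 hg; elim: w => [|a w IH].
  rewrite muln0 cylinder_nil; have <- : \prod_(i < 0) (1 : locop) = 1 by rewrite big_ord0.
  exact: subspace_power_prod.
have ha : subspace_power V c (letter a).
  case: (ltnP a K) => aK; last first.
    by rewrite letter_out //; exact: subspace0 (subspace_power_subspace V c).
  by apply: hg; rewrite mem_cat; apply/orP; right; apply: map_f; rewrite mem_iota.
rewrite cylinder_cons (_ : 3 * c * _ = c + c + 3 * c * size w + c)%N; last by rewrite /=; lia.
apply: subspace_powerM; last by apply: hg; rewrite !inE eqxx orbT.
apply: subspace_powerM => //; apply: subspace_powerM => //.
by apply: hg; rewrite inE eqxx.
Qed.

(** Applied to the constant function 1 and evaluated where one word of [s] occurs, every other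
    cylinder vanishes, as all words have the same length. *)
Lemma cylinder_indep (s : seq (seq nat)) n : uniq s ->
  (forall w, w \in s -> exists i, subword x i n = w) ->
  lin_indep (fun i : 'I_(size s) => cylinder (nth [::] s i)).
Proof.
move=> us hs c hc i.
have [q hq] := hs _ (mem_nth [::] (ltn_ord i)).
have sz j : (j < size s)%N -> size (nth [::] s j) = n.
  by move=> js; have [r <-] := hs _ (mem_nth [::] js); rewrite size_subword.
have : (\sum_(j < size s) c j *: cylinder (nth [::] s j) : locop) (fun=> 1) q = 0.
  by rewrite hc.
have sumE (r : seq 'I_(size s)) (G : 'I_(size s) -> locop) :
    (\sum_(j <- r) G j : locop) (fun=> 1) q = \sum_(j <- r) G j (fun=> 1) q.
  by elim: r => [|j r IH]; rewrite ?big_nil // !big_cons locopD IH.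
have E j : (c j *: cylinder (nth [::] s j) : locop) (fun=> 1) q =
    c j * (j == i)%:R.
  by rewrite locopZ /= sz // hq nth_uniq // eq_sym -(inj_eq val_inj j i); case: (_ == _).
rewrite sumE (eq_bigr _ (fun j _ => E j)) (bigD1 i) //= eqxx mulr1 big1 ?addr0 //.
by move=> j /negbTE->; rewrite mulr0.
Qed.

Lemma local_subspace N : linear_subspace [set F : locop | local x N F].
Proof.
apply/linear_subspaceP; split=> [|a F G [lF hF] [lG hG]].
  by split=> // a u v; apply/funext => i; rewrite /= !fctE /= scaler0 addr0.
split=> [b u v|i j u v xij uv]; first exact: locop_linear.
by rewrite !locopD !locopZ (hF i j u v) // (hG i j u v).
Qed.

Lemma local_power N (V : set locop) n : (forall F, V F -> local x N F) ->
  subspace_power V n `<=` [set F : locop | local x (N * n) F].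
Proof.
move=> hV; apply: linear_span_sub; first exact: local_subspace.
move=> _ [v hv <-] /=; elim: n v hv => [|n IH] v hv.
  by rewrite big_ord0 muln0; exact: local_id.
rewrite big_ord_recr /= mulnSr; apply: local_comp; last exact: hV.
by apply: IH => i; exact: hv.
Qed.

Lemma local_generating (V : set locop) : generating_subspace V ->
  exists2 N, (0 < N)%N & forall F, V F -> local x N F.
Proof.
move=> [_ [d [e [_ <-]]] _ _].
have /choice[N hN] : forall i, exists N, local x N (e i) by move=> i; exact: locopP.
(* The sum bounds the radii of all basis elements; the successor makes the radius positive, as the
   growth constants require. *)
pose M := (\sum_i N i).+1; exists M => // F.
have : linear_span (range e) `<=` [set F : locop | local x M F]; last by apply.
apply: linear_span_sub; first exact: local_subspace.
move=> _ [i _ <-]; apply: local_mono (hN i).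
by rewrite ltnW // ltnS (bigD1 i) //= leq_addr.
Qed.

Lemma set_seq_span (A : lmodType k) (s : seq A) :
  linear_span [set` s] `<=` linear_span (range (fun i : 'I_(size s) => nth 0 s i)).
Proof.
apply: linear_span_mono => a /= sa.
by have h := sa; rewrite -index_mem in h; exists (Ordinal h) => //=; rewrite nth_index.
Qed.

Lemma power_span N n (V : set locop) L : (forall F, V F -> local x N F) ->
  (forall i, subword x i (N * n).*2.+1 \in L) ->
  subspace_power V n `<=`
  linear_span (range (fun i : 'I_(size (band L (N * n))) => nth 0 (band L (N * n)) i)).
Proof.
move=> hV hL F hF; apply: set_seq_span; apply: local_span => //.
exact: local_power hV _ hF.
Qed.

(** Radii add under products, so the [n]-th power of [V] has radius [N * n] and is spanned by one
    band element per word and offset. *)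
Lemma growth_le N n (V : set locop) L : (forall F, V F -> local x N F) ->
  (forall i, subword x i (N * n).*2.+1 \in L) ->
  (growth V n <= size L * (N * n).*2.+1)%N.
Proof.
move=> hV hL; have := power_span hV hL.
rewrite /growth => /(subspace_dim_le (subspace_power_subspace V n)).
by rewrite size_allpairs size_iota.
Qed.

Lemma growth_mono (V : set locop) m n : generating_subspace V -> (m <= n)%N ->
  (growth V m <= growth V n)%N.
Proof.
move=> gV mn; have [N _ hN] := local_generating gV.
have [L hL] := subword_list (N * n).*2.+1.
apply: subspace_dim_mono (power_span hN hL) _; try exact: subspace_power_subspace.
by case: gV => _ _ V1 _; exact: subspace_power_mono.
Qed.

(** The cylinders of distinct factors of length [n] are independent and lie in a power of [V] whose
    exponent is linear in [n]. *)
Lemma growth_ge (V : set locop) : generating_subspace V -> exists2 c, (0 < c)%N &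
  forall s n, uniq s -> (forall w, w \in s -> exists i, subword x i n = w) ->
    (size s <= growth V (c * n))%N.
Proof.
move=> gV; have [_ _ V1 hV] := gV.
have [c c0 hc] := generating_power_uniform generators V1 hV.
exists (3 * c)%N; first by rewrite muln_gt0.
move=> s n us hs; have [N _ hN] := local_generating gV.
have [L hL] := subword_list (N * (3 * c * n)).*2.+1.
apply: subspace_dim_ge (power_span hN hL) (cylinder_indep us hs) _.
  exact: subspace_power_subspace.
move=> _ [i _ <-]; have [q hq] := hs _ (mem_nth [::] (ltn_ord i)).
by rewrite -[in X in subspace_power _ X](size_subword x q n) hq; exact: cylinder_power.
Qed.

End Structure.

(** * Simplicity for recurrent aperiodic words *)

Section Simple.
Variables (k : fieldType) (x : int -> nat).
Hypothesis x_recurrent : forall q L, exists R : nat, forall q',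
  exists2 l, (l < R)%N & subword x (q' + l%:Z) L = subword x q L.
Hypothesis x_aperiodic : forall e : nat, (0 < e)%N -> exists q, x q <> x (q + e%:Z).

Local Notation locop := (locop k x).
Local Notation delta := (@delta_fun k).
Local Notation translate := (@translate k x).
Local Notation returns := (@returns k x).

(** A place where the period [e] fails recurs in every window of some fixed length, so no window
    that large looks the same after a shift by [e]; finitely many [e] are treated by induction. *)
Lemma agree_far N : exists r : nat, forall i e,
  (0 < `|e|)%N -> (`|e| <= N)%N -> ~ agree r x x (i + e) i.
Proof.
have pos e : (0 < e)%N -> exists r : nat, forall i, ~ agree r x x (i + e%:Z) i.
  move=> e0; have [q hq] := x_aperiodic e0; have [R hR] := x_recurrent q e.+1.
  exists R => i h; have [l lR /eq_subwordP hl] := hR i; apply: hq.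
  have := hl 0%N isT; have := hl e (ltnSn e); rewrite !addr0 => <- <-.
  by rewrite (addrAC i) h //; lia.
elim: N => [|N [r IH]]; first by exists 0%N => i e; lia.
have [r' hr'] := pos N.+1 isT; exists (r + r')%N => i e e0 eN h.
have [eq_e|neq_e] := eqVneq `|e|%N N.+1; last first.
  by apply: (IH i e) => //; [lia|exact: agreeW (leq_addr _ _) h].
have {}h := agreeW (leq_addl r r') h.
have [ee|ee] : e = N.+1%:Z \/ e = - N.+1%:Z by lia.
  by apply: (hr' i); rewrite -ee.
by apply: (hr' (i + e)); rewrite {1}ee subrK; exact: agree_sym.
Qed.

Lemma agree_syndetic r i : exists R : nat, forall j, exists2 l, (l < R)%N &
  agree r x x (j + l%:Z) i.
Proof.
have [R hR] := x_recurrent (i - r%:Z) r.*2.+1.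
exists (R + r)%N => j; have [l lR hl] := hR j; exists (l + r)%N; first by lia.
by apply/agree_subword; rewrite PoszD addrA addrK.
Qed.

(* [returns r i] compresses an operator to its diagonal at the returns of the
   pattern seen around [i], where that diagonal is constant. *)
Lemma returns_compress r N (G : locop) i : local x N G -> (N <= r)%N ->
  (forall j e, (0 < `|e|)%N -> (`|e| <= N)%N -> ~ agree r x x (j + e) j) ->
  returns r i * G * returns r i = (G (delta i) i : k) *: returns r i.
Proof.
move=> [lG hG] Nr far; apply: locop_eq => u j; rewrite locopZ !locopM /=.
case: asboolP => [ji|_]; last by rewrite mulr0.
(* Within distance [N] of the return [j] there is no other return, so there the cut-off argument is
   supported at [j] alone, and locality transports the computation to [i]. *)
have -> : G (fun i0 => if `[< agree r x x i0 i >] then u i0 else 0) j =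
          G ((u j : k) *: delta i) i.
  apply: hG; first exact: agreeW Nr ji.
  have sE l : ((u j : k) *: delta i) l = u j * (l == i)%:R by [].
  move=> d dN; rewrite sE.
  have [->|d0] := eqVneq d 0.
    by rewrite !addr0 eqxx mulr1 asboolT.
  rewrite (_ : (i + d == i) = false) ?mulr0; last by apply/eqP; move/eqP: d0; lia.
  case: asboolP => // h; case: (far j d) => //; first by lia.
  exact: agree_trans h (agree_sym ji).
by rewrite locop_scale mulrC.
Qed.

(** A nonzero element of the ideal is shifted to have a nonzero diagonal entry and compressed to a
    projection [returns]. By recurrence finitely many translates of its support cover all integers,
    so the ideal contains 1. *)
Lemma locop_simple : simple_algebra locop.
Proof.
move=> I [[I0 IB] IM].
have {}I0 : I 0 by move: I0; rewrite inE.
have {}IB a b : I a -> I b -> I (a - b).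
  by move=> ha hb; have := IB a b; rewrite !inE; apply.
have IN a : I a -> I (- a) by move=> ha; rewrite -sub0r; exact: IB.
have ID a b : I a -> I b -> I (a + b).
  by move=> ha hb; rewrite -[b]opprK; apply: IB => //; exact: IN.
have [|nI] := pselect (I `<=` [set 0]).
  by left; apply/seteqP; split=> // _ ->.
right; apply/seteqP; split=> // a _.
suff I1 : I 1 by rewrite -[a]mulr1; exact: (IM a 1 I1).1.
have [F IF F0] : exists2 F, I F & F != 0.
  apply: contrapT => h; apply: nI => F IF; apply: contrapT => F0.
  by apply: h; exists F => //; apply/eqP.
have [N hF] := locopP F.
have [u [i Fui]] : exists u i, F u i != 0.
  apply: contrapT => h; case/eqP: F0; apply: locop_eq => u i.
  by apply/eqP/negPn/negP => hui; apply: h; exists u, i.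
have [d [dN Fd]] : exists d : int, (`|d| <= N)%N /\ F (delta (i + d)) i != 0.
  apply: contrapT => h; case/eqP: Fui; rewrite (local_expand _ _ hF) big_nat big1 // => l lN.
  have [->|hl] := eqVneq (F (delta (i - N%:Z + l%:Z)) i) 0; first by rewrite mulr0.
  by case: h; exists (l%:Z - N%:Z); rewrite addrCA addrC addrAC in hl *; split=> //; lia.
(* Composition with a translation brings the nonzero entry at offset [d] onto the diagonal. *)
pose G : locop := F * translate (- d).
have GE : G (delta i) i = F (delta (i + d)) i.
  rewrite locopM; congr (F _ i); apply/funext => j; rewrite /= /delta_fun.
  by rewrite subr_eq.
have IG : I G by exact: (IM (translate (- d)) F IF).2.
have [M hG] := locopP G.
have [r hr] := agree_far M.
(* The radius [r + M] serves both needs of the compression: [r] keeps returns apart by more than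
   [M], and [M] covers the radius of [G]. *)
have IDl : I (returns (r + M) i).
  have c0 : G (delta i) i != 0 by rewrite GE.
  have -> : returns (r + M) i = (G (delta i) i : k)^-1 *: (returns (r + M) i * G * returns (r + M) i).
    rewrite (returns_compress _ hG) ?leq_addl ?scalerA ?mulVf ?scale1r // => j e e0 eM h.
    exact: hr e0 eM (agreeW (leq_addr _ _) h).
  rewrite -mulr_algl; apply: (IM _ _ _).1; apply: (IM _ _ _).2.
  exact: (IM _ _ IG).1.
have [R hR] := agree_syndetic (r + M) i.
pose B := returns (r + M) i.
(* Inclusion-exclusion over finitely many translates of [returns] builds the
   projection onto the union of their supports, without leaving [I]. *)
have : forall n, exists2 P : locop, I P &
    forall u j, P u j = if `[< exists2 l, (l < n)%N & agree (r + M) x x (j + l%:Z) i >]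
                        then u j else 0.
  elim=> [|n [P IP hP]].
    by exists 0 => // v j; case: asboolP => // -[].
  pose Q := translate n%:Z * B * translate (- n%:Z).
  have IQ : I Q by apply: (IM _ _ _).2; exact: (IM _ _ IDl).1.
  exists (P + Q - P * Q).
    by apply: IB; [exact: ID|exact: (IM _ _ IQ).1].
  have hQ v j : Q v j = if `[< agree (r + M) x x (j + n%:Z) i >] then v j else 0.
    by rewrite !locopM /= addrK.
  move=> v j; rewrite locopD locopN locopD locopM !hP !hQ.
  case: (asboolP (exists2 l, (l < n)%N & _)) => h1.
    have [l ln hl] := h1; rewrite addrK asboolT //.
    by exists l => //; apply: ltnW.
  rewrite subr0 add0r; case: (asboolP (agree _ _ _ _ _)) => h2.
    by rewrite asboolT //; exists n.
  rewrite asboolF // => -[l]; rewrite ltnS leq_eqVlt => /predU1P[->//|ln hl].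
  by apply: h1; exists l.
move=> /(_ R)[P IP hP]; suff <- : P = 1 by [].
by apply: locop_eq => v j; rewrite hP asboolT //; exact: hR.
Qed.

End Simple.

(** * The theorem *)

Section Growth.
Local Open Scope nat_scope.
Variable f : nat -> nat.
Hypothesis f_pos : forall n, 0 < n -> 0 < f n.
Hypothesis f_incr : forall n, 0 < n -> f n < f n.+1.
Hypothesis f_submul : forall n m, 0 < n -> 0 < m -> f (n + m) <= f n * f m.
Hypothesis f_gap : forall B, exists N, forall n, N <= n ->
  B * f (2 ^ n.+1) <= f (2 ^ n) ^ 2.

(** The successor makes this exceed the true quotient, so the words never become too few. As the
    integer quotient is at least 1, it is at most doubled, a loss of [2 ^ n] over [n] levels, linear
    in the word length. *)
Definition ratio n := (f (2 ^ n.+1) %/ f (2 ^ n)).+1.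

Local Notation W := (W (2 * f 1) ratio).

Lemma f_mono m n : 0 < m -> m <= n -> f m <= f n.
Proof.
move=> m0 /subnKC <-; elim: (n - m) => [|d IH]; first by rewrite addn0.
by rewrite addnS (leq_trans IH) // ltnW // f_incr // addn_gt0 m0.
Qed.

Lemma f_pow_gt0 n : 0 < f (2 ^ n).
Proof. by rewrite f_pos // expn_gt0. Qed.

Lemma ratio_gt1 n : 1 < ratio n.
Proof.
rewrite /ratio ltnS divn_gt0 ?f_pow_gt0 // f_mono ?expn_gt0 //.
by rewrite leq_exp2l.
Qed.

Lemma ratio_le n : ratio n <= 2 * (f (2 ^ n.+1) %/ f (2 ^ n)).
Proof. by have := ratio_gt1 n; rewrite /ratio; lia. Qed.

Lemma f_double n : f (2 ^ n.+1) <= f (2 ^ n) * f (2 ^ n).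
Proof. by rewrite expnS mul2n -addnn f_submul // expn_gt0. Qed.

Lemma quotient_le n : f (2 ^ n.+1) %/ f (2 ^ n) <= f (2 ^ n).
Proof.
by rewrite -(leq_pmul2r (f_pow_gt0 n)) (leq_trans (leq_divM _ _)) // f_double.
Qed.

(** Submultiplicativity bounds the quotient by [f (2 ^ n)], hence [ratio n] by twice that; the
    alphabet has [2 * f 1] letters to provide this factor 2. *)
Lemma ratio_le_size n : 2 * f (2 ^ n) <= size (W n) -> ratio n <= size (W n).
Proof.
move=> h; have := ratio_le n; have := quotient_le n; lia.
Qed.

Lemma size_W_lower n : 2 * f (2 ^ n) <= size (W n).
Proof.
elim: n => [|n IH]; first by rewrite size_map size_iota.
have [_ ->] := size_WS_cond (ratio_le_size IH).
apply: leq_trans (leq_mul IH (leqnn _)); rewrite -mulnA leq_mul2l /= mulnC.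
by rewrite ltnW // ltn_ceil // f_pow_gt0.
Qed.

Lemma ratio_leW n : ratio n <= size (W n).
Proof. exact/ratio_le_size/size_W_lower. Qed.

Lemma size_W_upper n : size (W n) <= 2 ^ n.+1 * f (2 ^ n).
Proof.
elim: n => [|n IH]; first by rewrite size_map size_iota.
have [_ ->] := size_WS_cond (ratio_leW n).
apply: leq_trans (leq_mul IH (ratio_le n)) _.
by rewrite mulnACA -expnSr leq_mul2l mulnC leq_divM orbT.
Qed.

(** This is where condition (2) enters, in the form that recurrence of the word requires. *)
Lemma ratio_small B : exists N, forall n, N <= n -> B * ratio n <= size (W n).
Proof.
have [N hN] := f_gap B; exists N => n /hN h.
apply: leq_trans (size_W_lower n); apply: leq_trans (leq_mul (leqnn B) (ratio_le n)) _.
rewrite mulnCA leq_mul2l /= -(leq_pmul2r (f_pow_gt0 n)) mulnn.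
by apply: leq_trans h; rewrite -mulnA leq_mul2l leq_divM orbT.
Qed.

Definition word := biword (2 * f 1) ratio.

Lemma base_gt0 : 0 < 2 * f 1.
Proof. by rewrite muln_gt0 f_pos. Qed.

Lemma ratio_gt0 n : 0 < ratio n.
Proof. by []. Qed.

Lemma word_lt i : word i < 2 * f 1.
Proof. exact: (biword_lt base_gt0 ratio_gt0 ratio_leW). Qed.

Lemma dyadic_scale n : 0 < n -> exists m, n <= 2 ^ m <= 2 * n.
Proof.
move=> n0; have /andP[h1 h2] := trunc_log_bounds (isT : 1 < 2) n0.
by exists (trunc_log 2 n).+1; rewrite ltnW //= expnS leq_mul2l h1.
Qed.

Lemma word_complexity_le n : 0 < n -> exists2 L : seq (seq nat),
  size L <= 32 * (n * n) * f (4 * n) & forall i, subword word i n \in L.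
Proof.
move=> n0; have [m /andP[nm mn]] := dyadic_scale n0.
exists [seq take n w | w <- factors (2 * f 1) ratio m]; last first.
  move=> i; apply/mapP; exists (subword word i (2 ^ m)); last by rewrite take_subword.
  exact: (subword_factors base_gt0 ratio_gt0 ratio_leW).
rewrite size_map (size_factors base_gt0 ratio_leW).
apply: leq_trans (leq_mul (leqnn _) (size_W_upper _)) _.
rewrite mulnA; apply: leq_mul.
  (* The polynomial factor is [2 ^ m.+1 * 2 ^ m.+2], that is 8 times the square of [2 ^ m], and
     [2 ^ m] is at most [2 * n]. *)
  have := leq_mul mn mn; rewrite !expnS; lia.
apply: f_mono; first by rewrite expn_gt0.
by rewrite expnS; lia.
Qed.

Lemma word_complexity_ge n : 0 < n -> exists m (s : seq (seq nat)),
  [/\ 2 ^ m <= 2 * n, f n <= size s, uniq s &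
      forall w, w \in s -> exists i, subword word i (2 ^ m) = w].
Proof.
move=> n0; have [m /andP[nm mn]] := dyadic_scale n0; exists m, (W m); split=> //.
- apply: leq_trans (f_mono n0 nm) _; have := size_W_lower m; lia.
- exact: W_uniq.
move=> w wW; have [R /(_ 0%R)[l _ e]] :=
  W_recurrent base_gt0 ratio_gt0 ratio_leW ratio_small wW.
by exists (0 + l%:Z)%R.
Qed.

End Growth.

Theorem theorem2p3 (k : fieldType) (R : realType) (f : nat -> nat)
    (f_pos : forall n : nat, (0 < n)%N -> (0 < f n)%N)
    (f_incr : forall n : nat, (0 < n)%N -> (f n < f n.+1)%N)
    (f_submul : forall n m : nat, (0 < n)%N -> (0 < m)%N ->
      (f (n + m) <= f n * f m)%N)
    (f_cond1 : exists alpha : nat, (0 < alpha)%N /\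
      forall n : nat, (0 < n)%N -> (n * f n <= f (alpha * n))%N)
    (f_cond2 : forall beta : R, 0 < beta ->
      exists n_beta : nat, (0 < n_beta)%N /\
      forall n : nat, (n_beta <= n)%N ->
        (f (2 ^ n.+1)%N)%:R <= beta^-1 * (f (2 ^ n)%N)%:R ^+ 2)
    (f_cond3 : cvgn (fun N : nat =>
      \prod_(0 <= n < N)
        (1 + (f (2 ^ n)%N)%:R / (f (2 ^ n.+1)%N)%:R) : R)) :
  exists A : algType k,
    [/\ finitely_generated A, simple_algebra A & has_growth_type A f].
Proof.
have f_gap B : exists N, forall n, (N <= n)%N ->
    (B * f (2 ^ n.+1) <= f (2 ^ n) ^ 2)%N.
  case: B => [|B]; first by exists 0%N.
  have B0 : (0 : R) < B.+1%:R by rewrite ltr0n.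
  have [N [_ hN]] := f_cond2 _ B0; exists N => n /hN.
  by rewrite -ler_pdivrMl ?invr_gt0 // invrK -natrX -natrM ler_nat.
have xK := word_lt f_pos f_incr f_submul.
exists (locop k (word f)); split.
- exact: locop_finitely_generated xK.
- apply: locop_simple.
    move=> q L; exact: (biword_recurrent (base_gt0 f_pos) (@ratio_gt0 f)
      (ratio_leW f_pos f_incr f_submul) (ratio_small f_pos f_incr f_submul f_gap)).
  move=> e; exact: (biword_aperiodic (base_gt0 f_pos) (@ratio_gt0 f)
      (ratio_leW f_pos f_incr f_submul) (ratio_small f_pos f_incr f_submul f_gap)
      (ratio_gt1 f_pos f_incr)).
move=> V gV; have [c c0 hc] := growth_ge xK gV; have [N N0 hN] := local_generating gV.
have [a [a0 ha]] := f_cond1.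
(* The factor 2 comes from rounding [n] up to a power of 2. In the second constant, [a ^ 3] comes
   from three uses of condition (1), and 12 from [4 * l] with [l] at most [3 * (N * C)]. *)
exists (c * 2)%N, (12 * a ^ 3 * N * (c * 2))%N; split; rewrite ?muln_gt0 ?c0 ?N0 ?expn_gt0 ?a0 //.
move=> n n0; apply/andP; split.
  have [m [s [mn fs us hs]]] := word_complexity_ge f_pos f_incr f_submul f_gap n0.
  apply: leq_trans fs _; apply: leq_trans (hc _ _ us hs) _.
  by apply: (growth_mono xK gV); rewrite -mulnA leq_mul2l mn orbT.
set C := (c * 2 * n)%N; have C0 : (0 < C)%N by rewrite !muln_gt0 c0 n0.
have [L sL hL] := word_complexity_le f_pos f_incr f_submul (ltn0Sn (N * C).*2).
apply: leq_trans (growth_le hN hL) _.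
set l := (N * C).*2.+1 in sL *.
have l0 : (0 < l)%N by [].
apply: leq_trans (leq_mul sL (leqnn l)) _.
(* The growth is at most [32 * l ^ 3 * f (4 * l)]: two factors [l] come from the complexity and one
   from the band width. Each use of condition (1) absorbs one of them. *)
have h1 := ha (4 * l)%N ltac:(lia).
have h2 := ha (a * (4 * l))%N ltac:(lia).
have h3 := ha (a * (a * (4 * l)))%N ltac:(lia).
have al : (4 * l <= a * (4 * l))%N by rewrite leq_pmull.
have aal : (a * (4 * l) <= a * (a * (4 * l)))%N by rewrite leq_pmull.
have k2 := leq_trans (leq_mul al h1) h2.
have k3 := leq_trans (leq_mul (leq_trans al aal) k2) h3.
have lN : (l <= 3 * (N * C))%N by have := muln_gt0 N C; rewrite N0 C0 /l; lia.
apply: leq_trans (leq_trans k3 (f_mono f_incr _ _)).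
- by move: (f _) => F; lia.
- by rewrite !muln_gt0 a0.
have e : (12 * a ^ 3 * N * (c * 2) * n = a * (a * (a * (4 * (3 * (N * C))))))%N.
  by rewrite /C !expnS expn0; lia.
by rewrite e !leq_mul.
Qed.
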